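(* Let $\Gamma$ be an additive subgroup of $\mathbb{C}$ containing $1$, let $f\in\Gamma^\vee$ and $\alpha\in\mathbb{C}$. (i) The $\mathcal{W}_\Gamma$-module $\Omega_\Gamma(f,\alpha)$ is simple if and only if $\alpha\neq0$. (ii) The module $\Omega_\Gamma(f,0)$ has a unique simple submodule $N$; moreover $N\cong\Omega_\Gamma(f,1)$ and $\Omega_\Gamma(f,0)/N$ is a trivial module.
   Context: The base field is $\mathbb{C}$. $\Gamma^\vee$ is the set of group homomorphisms $\Gamma\to\mathbb{C}^*$. $\mathcal{W}_\Gamma$ is the Lie algebra with basis $\{L_m\}_{m\in\Gamma}$ and bracket $[L_m,L_n]=(m-n)L_{m+n}$. $\Omega_\Gamma(f,\alpha)$ is the vector space $\mathbb{C}[L_0]$ of polynomials with the $\mathcal{W}_\Gamma$-action $L_mP(L_0)=f(m)(L_0+m\alpha)P(L_0+m)$. ''A trivial module'' means the one-dimensional trivial representation. *)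

(* Defs.v *)
From HB Require Import structures.
From mathcomp Require Import all_boot all_order all_algebra.
From mathcomp Require Import finmap.
From mathcomp Require Import complex.
From mathcomp Require Import monalg.
From mathcomp Require Import reals.
From mathcomp Require Import ring.

Set Implicit Arguments.
Unset Strict Implicit.
Unset Printing Implicit Defensive.

Import GRing.Theory Num.Theory.

Local Open Scope ring_scope.

HB.mixin Record Lmodule_isLieAlgebra (K : comNzRingType) (g : Type)
    of GRing.Lmodule K g := {
  bracket : g -> g -> g;
  bracket_linear_l : forall y, linear (bracket^~ y);
  bracket_linear_r : forall x, linear (bracket x);
  bracket_alt : forall x, bracket x x = 0;
  bracket_jacobi : forall x y z,
    bracket x (bracket y z) + bracket y (bracket z x)
      + bracket z (bracket x y) = 0
}.

#[short(type="lieAlgType")]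
HB.structure Definition LieAlgebra (K : comNzRingType) :=
  { g of Lmodule_isLieAlgebra K g & GRing.Lmodule K g }.

HB.mixin Record Lmodule_isLieModule (K : comNzRingType) (g : lieAlgType K)
    (V : Type) of GRing.Lmodule K V := {
  lie_act : g -> V -> V;
  lie_act_linear_l : forall v, linear (lie_act^~ v);
  lie_act_linear_r : forall x, linear (lie_act x);
  lie_act_bracket : forall x y v,
    lie_act (bracket x y) v = lie_act x (lie_act y v) - lie_act y (lie_act x v)
}.

#[short(type="lieModType")]
HB.structure Definition LieModule (K : comNzRingType) (g : lieAlgType K) :=
  { V of Lmodule_isLieModule K g V & GRing.Lmodule K V }.

Arguments lie_act {K g s} x v.
Arguments lieModType {K} g.

(* Submodules are boolean predicates; in presence of the classical axioms, this
   covers all subsets. *)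
HB.mixin Record isLieStable (K : comNzRingType) (g : lieAlgType K)
    (V : lieModType g) (N : V -> bool) := {
  lie_stable : forall (x : g) v, v \in N -> lie_act x v \in N
}.

#[short(type="lieSubmod")]
HB.structure Definition LieSubmodule (K : comNzRingType) (g : lieAlgType K)
    (V : lieModType g) :=
  { N of isLieStable K g V N & @GRing.SubmodClosed K V N }.

Arguments lieSubmod {K g} V.

Section SubLieModule.
Variables (K : comNzRingType) (g : lieAlgType K) (V : lieModType g).
Variable N : lieSubmod V.

Record subLieMod : predArgType :=
  SubLieMod { subLieMod_val :> V; _ : subLieMod_val \in N }.

HB.instance Definition _ := [isSub for subLieMod_val].
HB.instance Definition _ := [Choice of subLieMod by <:].
HB.instance Definition _ := [SubChoice_isSubLmodule of subLieMod by <:].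

Lemma subLieMod_act_subproof x (u : subLieMod) :
  lie_act x (val u) \in N.
Proof. exact/lie_stable/valP. Qed.

Definition subLieMod_act (x : g) (u : subLieMod) : subLieMod :=
  SubLieMod (subLieMod_act_subproof x u).

Fact subLieMod_act_linear_l u : linear (subLieMod_act^~ u).
Proof. by move=> a x y; apply/val_inj/lie_act_linear_l. Qed.

Fact subLieMod_act_linear_r x : linear (subLieMod_act x).
Proof. by move=> a u v; apply/val_inj/lie_act_linear_r. Qed.

Fact subLieMod_act_bracket x y u :
  subLieMod_act (bracket x y) u =
  subLieMod_act x (subLieMod_act y u) - subLieMod_act y (subLieMod_act x u).
Proof. exact/val_inj/lie_act_bracket. Qed.

HB.instance Definition _ := Lmodule_isLieModule.Build K g subLieMod
  subLieMod_act_linear_l subLieMod_act_linear_r subLieMod_act_bracket.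

End SubLieModule.

Section QuotLieModule.
Variables (K : comNzRingType) (g : lieAlgType K) (V : lieModType g).
Variable N : lieSubmod V.

Fact lieSubmod_oppr_closed : oppr_closed N.
Proof. by move=> v Nv; rewrite -scaleN1r rpredZ. Qed.

HB.instance Definition _ :=
  GRing.isOppClosed.Build V (N : V -> bool) lieSubmod_oppr_closed.

Definition quotLieMod : predArgType := Quotient.quot N.

HB.instance Definition _ := GRing.Zmodule.on quotLieMod.
HB.instance Definition _ : EqQuotient V (Quotient.equiv N) quotLieMod :=
  EqQuotient.on quotLieMod.

Local Notation pi := (\pi_quotLieMod)%qT.

Fact quotLieMod_eq u v : (pi u = pi v) <-> (u - v \in N).
Proof. by rewrite Quotient.idealrBE; split=> /eqP. Qed.

Fact quotLieMod_piD u v : pi (u + v) = pi u + pi v.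
Proof. exact: (@Quotient.pi_add V N). Qed.

Definition quotLieMod_scale (a : K) : quotLieMod -> quotLieMod :=
  lift_op1 quotLieMod ( *:%R a).

Definition quotLieMod_act (x : g) : quotLieMod -> quotLieMod :=
  lift_op1 quotLieMod (lie_act x).

Fact quotLieMod_piZ a v : pi (a *: v) = quotLieMod_scale a (pi v).
Proof.
rewrite /quotLieMod_scale; unlock; apply/quotLieMod_eq.
rewrite -scalerBr rpredZ //.
by apply/quotLieMod_eq; rewrite reprK.
Qed.

Fact quotLieMod_pi_act x v : pi (lie_act x v) = quotLieMod_act x (pi v).
Proof.
rewrite /quotLieMod_act; unlock; apply/quotLieMod_eq.
rewrite -scaleN1r addrC -lie_act_linear_r lie_stable //.
by rewrite scaleN1r addrC; apply/quotLieMod_eq; rewrite reprK.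
Qed.

Fact quotLieMod_scaleA a b u :
  quotLieMod_scale a (quotLieMod_scale b u) = quotLieMod_scale (a * b) u.
Proof. by rewrite -[u]reprK -!quotLieMod_piZ scalerA. Qed.

Fact quotLieMod_scale1 : left_id 1 quotLieMod_scale.
Proof. by move=> u; rewrite -[u]reprK -quotLieMod_piZ scale1r. Qed.

Fact quotLieMod_scaleDr : right_distributive quotLieMod_scale +%R.
Proof.
move=> a u v; rewrite -[u]reprK -[v]reprK.
by rewrite -!(quotLieMod_piD, quotLieMod_piZ) scalerDr.
Qed.

Fact quotLieMod_scaleDl u : {morph quotLieMod_scale^~ u : a b / a + b}.
Proof.
by move=> a b; rewrite -[u]reprK -!(quotLieMod_piD, quotLieMod_piZ) scalerDl.
Qed.

HB.instance Definition _ := GRing.Zmodule_isLmodule.Build K quotLieMod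
  quotLieMod_scaleA quotLieMod_scale1 quotLieMod_scaleDr quotLieMod_scaleDl.

Fact quotLieMod_act_linear_l u : linear (quotLieMod_act^~ u).
Proof.
move=> a x y; rewrite -[u]reprK -!quotLieMod_pi_act lie_act_linear_l.
by rewrite quotLieMod_piD quotLieMod_piZ.
Qed.

Fact quotLieMod_act_linear_r x : linear (quotLieMod_act x).
Proof.
move=> a u v; rewrite -[u]reprK -[v]reprK -[a *: _]quotLieMod_piZ.
rewrite -quotLieMod_piD -!quotLieMod_pi_act lie_act_linear_r.
by rewrite quotLieMod_piD quotLieMod_piZ.
Qed.

Fact quotLieMod_act_bracket x y u :
  quotLieMod_act (bracket x y) u =
  quotLieMod_act x (quotLieMod_act y u) - quotLieMod_act y (quotLieMod_act x u).
Proof.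
rewrite -[u]reprK -!quotLieMod_pi_act lie_act_bracket quotLieMod_piD.
by congr (_ + _); exact: (@Quotient.pi_opp V N).
Qed.

HB.instance Definition _ := Lmodule_isLieModule.Build K g quotLieMod
  quotLieMod_act_linear_l quotLieMod_act_linear_r quotLieMod_act_bracket.

End QuotLieModule.

(* The one-dimensional trivial representation of g. *)
Definition trivLieMod (K : comNzRingType) (g : lieAlgType K) : predArgType :=
  (K^o : Type).

HB.instance Definition _ (K : comNzRingType) (g : lieAlgType K) :=
  GRing.Lmodule.copy (trivLieMod g) K^o.

Section TrivialLieModule.
Variables (K : comNzRingType) (g : lieAlgType K).
Local Notation trivLieMod := (trivLieMod g).

Definition trivLieMod_act (x : g) (v : trivLieMod) : trivLieMod := 0.

Fact trivLieMod_act_linear_l v : linear (trivLieMod_act^~ v).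
Proof. by move=> a x y; rewrite /trivLieMod_act scaler0 addr0. Qed.

Fact trivLieMod_act_linear_r x : linear (trivLieMod_act x).
Proof. by move=> a u v; rewrite /trivLieMod_act scaler0 addr0. Qed.

Fact trivLieMod_act_bracket x y v :
  trivLieMod_act (bracket x y) v =
  trivLieMod_act x (trivLieMod_act y v) - trivLieMod_act y (trivLieMod_act x v).
Proof. by rewrite /trivLieMod_act subr0. Qed.

HB.instance Definition _ := Lmodule_isLieModule.Build K g trivLieMod
  trivLieMod_act_linear_l trivLieMod_act_linear_r trivLieMod_act_bracket.

End TrivialLieModule.

Section LieModulePredicates.
Variables (K : comNzRingType) (g : lieAlgType K).

Definition lieMod_iso (V W : lieModType g) : Prop :=
  exists phi : {linear V -> W},
    bijective phi /\ forall x v, phi (lie_act x v) = lie_act x (phi v).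

Definition simple_lieMod (V : lieModType g) : Prop :=
  (exists v : V, v != 0) /\
  forall N : lieSubmod V,
    (forall v, v \in N -> v = 0) \/ (forall v, v \in N).

End LieModulePredicates.

(* {malg K[G]} is used only as the free K-module on G, not as a monoid algebra. *)
Section LinearExtension.
Variables (K : comNzRingType) (G : choiceType) (V : lmodType K) (h : G -> V).

Definition linext (x : {malg K[G]}) : V := \sum_(m <- msupp x) x@_m *: h m.

Lemma linextEw (d : {fset G}) x :
  (msupp x `<=` d)%fset -> linext x = \sum_(m <- d) x@_m *: h m.
Proof.
move=> le; rewrite [LHS](big_fset_incl _ le) => //= m _ /mcoeff_outdom ->.
by rewrite scale0r.
Qed.

Lemma linextU m : linext << m >> = h m.
Proof. by rewrite (linextEw msuppU_le) big_seq_fset1 mcoeffUU scale1r. Qed.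

Fact linext_is_linear : linear linext.
Proof.
move=> a x y.
have le1 : (msupp x `<=` msupp x `|` msupp y)%fset by exact: fsubsetUl.
have le2 : (msupp y `<=` msupp x `|` msupp y)%fset by exact: fsubsetUr.
have le3 : (msupp (a *: x + y) `<=` msupp x `|` msupp y)%fset.
  by apply: fsubset_trans (msuppD_le _ _) _; apply: fsetSU; apply: msuppZ_le.
rewrite (linextEw le1) (linextEw le2) (linextEw le3) scaler_sumr -big_split /=.
by apply: eq_bigr => m _; rewrite mcoeffD mcoeffZ scalerDl scalerA.
Qed.

HB.instance Definition _ :=
  GRing.isLinear.Build K {malg K[G]} V *:%R linext linext_is_linear.

End LinearExtension.

Lemma malg_ext (K : comNzRingType) (G : choiceType) (V : lmodType K)
    (p q : {malg K[G]} -> V) :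
  linear p -> linear q -> (forall m, p << m >> = q << m >>) -> p =1 q.
Proof.
have linE (r : {linear {malg K[G]} -> V}) x :
    r x = \sum_(m <- msupp x) x@_m *: r << m >>.
  rewrite [x in LHS]monalgE !raddf_sum; apply: eq_bigr => m _.
  have -> : << x@_m *g m >> = x@_m *: << m >> :> {malg K[G]}.
    by apply/malgP => k; rewrite mcoeffZ !mcoeffU mulr_natr.
  by rewrite /= linearZ.
move=> lp lq pq x.
pose P : {linear {malg K[G]} -> V} :=
  HB.pack p (GRing.isLinear.Build K {malg K[G]} V *:%R p lp).
pose Q : {linear {malg K[G]} -> V} :=
  HB.pack q (GRing.isLinear.Build K {malg K[G]} V *:%R q lq).
rewrite [LHS](linE P) [RHS](linE Q).
by apply: eq_bigr => m _; congr (_ *: _); apply: pq.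
Qed.

Section SubgroupElt.
Variables (K : zmodType) (Gamma : zmodClosed K).

Record subgroup_elt : predArgType :=
  SubgroupElt { subgroup_val :> K; _ : subgroup_val \in Gamma }.

HB.instance Definition _ := [isSub for subgroup_val].
HB.instance Definition _ := [Choice of subgroup_elt by <:].
HB.instance Definition _ := [SubChoice_isSubZmodule of subgroup_elt by <:].

End SubgroupElt.

(* Gamma^vee, the set of homomorphisms from Gamma to K^*. *)
Record mult_char (K : fieldType) (Gamma : zmodClosed K) := MultChar {
  mult_char_fun :> subgroup_elt Gamma -> K;
  mult_char_neq0 : forall m, mult_char_fun m != 0;
  mult_charD : forall m n,
    mult_char_fun (m + n) = mult_char_fun m * mult_char_fun n
}.

Lemma subgroup_valD (K : zmodType) (Gamma : zmodClosed K)
  (m n : subgroup_elt Gamma) : val (m + n) = val m + val n.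
Proof. by []. Qed.

(* The Lie algebra W_Gamma, as the free module on Gamma: its basis vector L_m is
   the generator << m >>, and the bracket is extended bilinearly from
   [L_m, L_n] = (m - n) L_(m + n) (see witt_bracketL). *)
Definition witt (K : numFieldType) (Gamma : zmodClosed K) : predArgType :=
  {malg K[subgroup_elt Gamma]}.

HB.instance Definition _ (K : numFieldType) (Gamma : zmodClosed K) :=
  GRing.Lmodule.on (witt Gamma).

HB.lock Definition witt_L (K : numFieldType) (Gamma : zmodClosed K)
  (m : subgroup_elt Gamma) : witt Gamma := << m >>.

HB.lock Definition witt_bracket (K : numFieldType) (Gamma : zmodClosed K)
    (x y : witt Gamma) : witt Gamma :=
  linext (fun m => linext (fun n => (val m - val n) *: witt_L (m + n)) y) x.

Lemma opp_fixed (K : numFieldType) (V : lmodType K) (v : V) : v = - v -> v = 0.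
Proof.
move=> /eqP; rewrite -subr_eq0 opprK -mulr2n -scaler_nat.
by rewrite scaler_eq0 pnatr_eq0 => /eqP.
Qed.

Lemma lincomb3 (K : comNzRingType) (V : lmodType K) (a : K) (x y z u v w : V) :
  (a *: x + u) + (a *: y + v) + (a *: z + w) = a *: (x + y + z) + (u + v + w).
Proof. by rewrite !scalerDr (addrACA (a *: x)) (addrACA (_ + _)). Qed.

Lemma scaler3_eq0 (K : comNzRingType) (V : lmodType K) (a b c : K) (v : V) :
  a + b + c = 0 -> a *: v + b *: v + c *: v = 0.
Proof. by rewrite -!scalerDl => ->; rewrite scale0r. Qed.

Section WittAlgebra.
Variables (K : numFieldType) (Gamma : zmodClosed K).
Local Notation G := (subgroup_elt Gamma).
Local Notation W := (witt Gamma).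
Local Notation L := (@witt_L K Gamma).
Local Notation br := (@witt_bracket K Gamma).

Lemma witt_linextL (V : lmodType K) (h : G -> V) m : linext h (L m) = h m.
Proof. by rewrite witt_L.unlock linextU. Qed.

Lemma witt_ext (V : lmodType K) (p q : W -> V) :
  linear p -> linear q -> (forall m, p (L m) = q (L m)) -> p =1 q.
Proof. by move=> lp lq pq; apply: malg_ext => // m; rewrite witt_L.unlock in pq. Qed.

Lemma witt_bracketL m n :
  br (L m) (L n) = (val m - val n) *: L (m + n).
Proof. by rewrite witt_bracket.unlock !witt_linextL. Qed.

Fact witt_bracket_linear_l y : linear (br^~ y : W -> W).
Proof. by rewrite witt_bracket.unlock; apply: linext_is_linear. Qed.

Fact witt_bracket_linear_r x : linear (br x : W -> W).
Proof.
move=> a y z; rewrite witt_bracket.unlock [in RHS]/linext.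
rewrite scaler_sumr -big_split /=.
by apply: eq_bigr => m _; rewrite linearP scalerDr !scalerA mulrC.
Qed.

Fact witt_bracketC x y : br x y = - br y x :> W.
Proof.
apply: (witt_ext (p := br^~ y) (q := fun x => - br y x)).
- exact: witt_bracket_linear_l.
- by move=> a u v; rewrite witt_bracket_linear_r opprD scalerN.
move=> m.
apply: (witt_ext (p := br (L m)) (q := fun y => - br y (L m))).
- exact: witt_bracket_linear_r.
- by move=> a u v; rewrite witt_bracket_linear_l opprD scalerN.
by move=> n; rewrite !witt_bracketL -scaleNr opprB (addrC n m).
Qed.

Fact witt_bracket_alt x : br x x = 0 :> W.
Proof. exact/opp_fixed/witt_bracketC. Qed.

Let jacobian (x y z : W) :=
  br x (br y z) + br y (br z x) + br z (br x y).

Let jacobianC x y z : jacobian x y z = jacobian y z x.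
Proof. by rewrite /jacobian -addrA addrC. Qed.

Let jacobian_linear y z : linear (fun x => jacobian x y z).
Proof.
move=> a x x'; rewrite /jacobian.
rewrite !(witt_bracket_linear_l, witt_bracket_linear_r).
exact: lincomb3.
Qed.

Fact witt_bracket_jacobi x y z :
  br x (br y z) + br y (br z x) + br z (br x y) = 0.
Proof.
have ext u v : (forall m, jacobian (L m) u v = 0) -> forall t, jacobian t u v = 0.
  apply: (witt_ext (p := fun t => jacobian t u v) (q := fun=> 0)) => //.
  by move=> a ? ?; rewrite scaler0 addr0.
rewrite -/(jacobian x y z); move: x; apply: (ext) => m.
rewrite jacobianC; move: y; apply: (ext) => n.
rewrite jacobianC; move: z; apply: (ext) => k.
have brZ a u v : br u (a *: v) = a *: br u v.
  by have:= scalable_linear (witt_bracket_linear_r u) a v.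
rewrite /jacobian !witt_bracketL !brZ !witt_bracketL !scalerA.
rewrite (_ : m + (n + k) = k + (m + n)); last by rewrite addrA (addrC (m + n)).
rewrite (addrCA n) (addrC n).
by apply: (@scaler3_eq0 K W); rewrite !subgroup_valD; ring.
Qed.

HB.instance Definition _ := Lmodule_isLieAlgebra.Build K W
  witt_bracket_linear_l witt_bracket_linear_r witt_bracket_alt
  witt_bracket_jacobi.

End WittAlgebra.

Definition Omega (K : numFieldType) (Gamma : zmodClosed K)
  (f : mult_char Gamma) (alpha : K) : predArgType := {poly K}.

HB.instance Definition _ (K : numFieldType) (Gamma : zmodClosed K)
  (f : mult_char Gamma) (alpha : K) := GRing.Lmodule.on (Omega f alpha).

(* C[L_0] is realized as {poly K}, with L_0 as the indeterminate 'X; the action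
   below of the basis vector L_m is extended linearly in Omega_act. *)
Definition Omega_gen (K : numFieldType) (Gamma : zmodClosed K)
    (f : mult_char Gamma) (alpha : K) (m : subgroup_elt Gamma)
    (P : Omega f alpha) : Omega f alpha :=
  f m *: (('X + (val m * alpha)%:P) * (P \Po ('X + (val m)%:P))).

HB.lock Definition Omega_act (K : numFieldType) (Gamma : zmodClosed K)
    (f : mult_char Gamma) (alpha : K) (x : witt Gamma) (P : Omega f alpha) :
    Omega f alpha :=
  linext (fun m => Omega_gen m P) x.

Section OmegaModule.
Variables (K : numFieldType) (Gamma : zmodClosed K).
Variables (f : mult_char Gamma) (alpha : K).
Local Notation L := (@witt_L K Gamma).
Local Notation W := (witt Gamma).
Local Notation Om := (Omega f alpha).
Local Notation act := (@Omega_act K Gamma f alpha).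

Lemma Omega_actL m P : act (L m) P = Omega_gen m P.
Proof. by rewrite Omega_act.unlock witt_linextL. Qed.

Fact Omega_act_linear_l P : linear (act^~ P).
Proof. by rewrite Omega_act.unlock; apply: linext_is_linear. Qed.

Fact Omega_gen_linear m : linear (@Omega_gen _ _ f alpha m).
Proof.
move=> a P Q; rewrite /Omega_gen linearP mulrDr scalerDr /=.
by congr (_ + _); rewrite -scalerAr !scalerA mulrC.
Qed.

Fact Omega_act_linear_r x : linear (act x).
Proof.
move=> a P Q; rewrite Omega_act.unlock [in RHS]/linext.
rewrite scaler_sumr -big_split /=; apply: eq_bigr => m _.
by rewrite Omega_gen_linear scalerDr [in LHS]scalerA [in RHS]scalerA (mulrC a).
Qed.

Fact Omega_gen_bracket m n P :
  (val m - val n) *: Omega_gen (m + n) P =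
  Omega_gen m (Omega_gen n P) - Omega_gen n (Omega_gen m P) :> Om.
Proof.
rewrite /Omega_gen !mult_charD !linearZ /= !comp_polyM -!comp_polyA.
rewrite !(comp_polyD, comp_polyX, comp_polyC) -!addrA -!polyCD.
rewrite (addrC (val n) (val m)).
rewrite -!mul_polyC !(polyCD, polyCM, polyCN).
by ring.
Qed.

Fact Omega_act_bracket x y P :
  act (bracket x y) P = act x (act y P) - act y (act x P).
Proof.
have actZ a u Q : act (a *: u) Q = a *: act u Q.
  by have:= scalable_linear (Omega_act_linear_l Q) a u.
have subl a (p q r s : Om) : a *: p + q - (a *: r + s) = a *: (p - r) + (q - s).
  by rewrite opprD scalerBr addrACA.
move: x; apply: (witt_ext (p := fun x => act (bracket x y) P)
                          (q := fun x => act x (act y P) - act y (act x P))).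
- by move=> a u v; rewrite bracket_linear_l Omega_act_linear_l.
- by move=> a u v; rewrite !Omega_act_linear_l Omega_act_linear_r subl.
move=> m; move: y.
apply: (witt_ext (p := fun y => act (bracket (L m) y) P)
                 (q := fun y => act (L m) (act y P) - act y (act (L m) P))).
- by move=> a u v; rewrite bracket_linear_r Omega_act_linear_l.
- by move=> a u v; rewrite !Omega_act_linear_l Omega_act_linear_r subl.
move=> n; rewrite (_ : bracket _ _ = (val m - val n) *: L (m + n)).
  by rewrite actZ !Omega_actL Omega_gen_bracket.
exact: witt_bracketL.
Qed.

HB.instance Definition _ := Lmodule_isLieModule.Build K W Om
  Omega_act_linear_l Omega_act_linear_r Omega_act_bracket.

End OmegaModule.

(* Main.v *)
From HB Require Import structures.
Require Import Defs.
From mathcomp Require Import all_boot all_order all_algebra.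
From mathcomp Require boolp.
From mathcomp Require Import complex reals.

Import GRing.Theory Num.Theory.
Local Open Scope ring_scope.

(** Since L_0 acts as multiplication by the indeterminate X, a submodule of
    Omega(f, alpha) is an ideal of K[X], hence is governed by its zeros: over an
    algebraically closed field, a nonzero ideal without common zero contains the
    generator 1 (Omega_submod_common_root).  The remaining L_m constrain the
    zeros: if P is in the submodule, so is (X + m alpha) P(X + m)
    (Omega_submod_shift), so a common zero r satisfies
    (r + m alpha) P(r + m) = 0 for every m in Gamma.  As Gamma contains the
    natural numbers and, for alpha != 0, the factor r + k alpha vanishes for at
    most one natural number k, P would have infinitely many roots.  So there is
    no common zero, and Omega(f, alpha) is simple (Omega_simple).

    For alpha = 0, the image of each L_m lies in the ideal N = X K[X] of the
    polynomials vanishing at 0.  Thus N is a proper nonzero submodule and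
    evaluation at 0 identifies Omega(f, 0)/N with the trivial module
    (Omega0_quot_iso).  Moreover
      L_m (X Q) = f(m) X (X + m) Q(X + m) = X (L_m Q),
    where the last L_m is that of Omega(f, 1); so multiplication by X is an
    isomorphism from Omega(f, 1) to N (Omega0_sub_iso), and N is simple.
    Finally, for P nonzero in a submodule N', the polynomial X P is a nonzero
    element of N and N' at once; two simple submodules which meet nontrivially
    are equal, whence the uniqueness of N (Omega0_simple_sub_unique). *)

(** * Submodules and isomorphisms of Lie modules *)

Lemma ex_lieSubmod {K : comNzRingType} {g : lieAlgType K} {V : lieModType g}
    (N : V -> bool) :
  submod_closed N -> (forall x v, v \in N -> lie_act x v \in N) ->
  exists N' : lieSubmod V, N' =i N.
Proof.
move=> subN stabN.
pose N' : lieSubmod V := HB.pack N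
  (GRing.isSubmodClosed.Build K V N subN) (isLieStable.Build K g V N stabN).
by exists N'.
Qed.

Lemma ex_preim_lieSubmod {K : comNzRingType} {g : lieAlgType K}
    {V W : lieModType g} (phi : {linear V -> W}) (M : lieSubmod W) :
  (forall x v, phi (lie_act x v) = lie_act x (phi v)) ->
  exists M' : lieSubmod V, forall v, (v \in M') = (phi v \in M).
Proof.
move=> phi_act; pose P : V -> bool := fun v => phi v \in M.
apply: (ex_lieSubmod P); first split; first 1 last.
- move=> a u v Mu Mv; rewrite -topredE /= /P linearP.
  by apply: rpredD => //; apply: rpredZ.
- by move=> x v Mv; rewrite -topredE /= /P phi_act; apply: lie_stable.
- by rewrite -topredE /= /P linear0 rpred0.
Qed.

Lemma lieMod_isoI {K : comNzRingType} {g : lieAlgType K} {V W : lieModType g}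
    (phi : V -> W) :
  linear phi -> bijective phi ->
  (forall x v, phi (lie_act x v) = lie_act x (phi v)) -> lieMod_iso V W.
Proof.
move=> phi_lin phi_bij phi_act.
pose Phi : {linear V -> W} :=
  HB.pack phi (GRing.isLinear.Build K V W *:%R phi phi_lin).
by exists Phi.
Qed.

Lemma simple_lieMod_iso {K : comNzRingType} {g : lieAlgType K}
    (V W : lieModType g) :
  lieMod_iso V W -> simple_lieMod W -> simple_lieMod V.
Proof.
case=> phi [[psi phiK psiK] phi_act] [[w w0] simW].
have psi_lin : linear psi.
  by move=> a u v; apply: (can_inj phiK); rewrite linearP !psiK.
pose Psi : {linear W -> V} :=
  HB.pack psi (GRing.isLinear.Build K W V *:%R psi psi_lin).
split.
  by exists (psi w); apply: contraNneq w0 => e; rewrite -(psiK w) e linear0.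
move=> N; have [|M ME] := ex_preim_lieSubmod Psi N.
  by move=> x v; apply: (can_inj phiK); rewrite phi_act /= !psiK.
case: (simW M) => trivM; [left=> v Nv | right=> v].
  by rewrite -(phiK v) (trivM (phi v)) ?[LHS](linear0 Psi) // ME /= phiK.
by have := trivM (phi v); rewrite ME /= phiK.
Qed.

(** The intersection of N and M is a submodule of N, here obtained as the
    preimage of M under the inclusion of N; simplicity leaves only N itself. *)
Lemma simple_subLieMod_sub {K : comNzRingType} {g : lieAlgType K}
    {V : lieModType g} {N M : lieSubmod V} {v : V} :
  simple_lieMod (subLieMod N) -> v \in N -> v \in M -> v != 0 ->
  {subset N <= M}.
Proof.
move=> [_ simN] Nv Mv v0.
have [|M' M'E] := ex_preim_lieSubmod
  (val : {linear subLieMod N -> V}) M; first by [].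
case: (simN M') => trivM' u Nu.
  case/eqP: v0; have := trivM' (SubLieMod Nv).
  by rewrite M'E => /(_ Mv) /(congr1 val).
by have := trivM' (SubLieMod Nu); rewrite M'E.
Qed.

(** * Submodules of Omega as ideals of polynomials *)

Section Omega.
Context {K : numFieldType} {Gamma : zmodClosed K} {f : mult_char Gamma}.

Lemma Omega_actE {alpha : K} (x : witt Gamma) (P : Omega f alpha) :
  lie_act x P = linext (fun m => Omega_gen m P) x.
Proof. by rewrite /lie_act /= Omega_act.unlock. Qed.

Section Submodule.
Context {alpha : K} {N : lieSubmod (Omega f alpha)}.

(** The scalar f(m) is invertible, so that it can be dropped from L_m P: the
    character f is invisible to submodules. *)
Lemma Omega_submod_shift (m : subgroup_elt Gamma) {P : {poly K}} :
  (P : Omega f alpha) \in N ->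
  (('X + (val m * alpha)%:P) * (P \Po ('X + (val m)%:P)) : Omega f alpha) \in N.
Proof.
move=> NP; have := lie_stable (witt_L m) _ NP.
rewrite Omega_actE witt_linextL => /(rpredZ (f m)^-1).
by rewrite scalerA mulVf ?mult_char_neq0 // scale1r.
Qed.

(** For m = 0 the shifted polynomial is X P: this is the action of L_0. *)
Lemma Omega_submodX {P : {poly K}} : (P : Omega f alpha) \in N ->
  ('X * P : Omega f alpha) \in N.
Proof.
by move=> /(Omega_submod_shift 0); rewrite mul0r !addr0 comp_polyXr.
Qed.

Lemma Omega_submodM {P : {poly K}} (Q : {poly K}) : (P : Omega f alpha) \in N ->
  (Q * P : Omega f alpha) \in N.
Proof.
move=> NP; elim/poly_ind: Q => [|Q c IH]; first by rewrite mul0r rpred0.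
rewrite mulrDl mul_polyC -mulrA mulrCA.
by apply: rpredD; [apply: Omega_submodX | apply: rpredZ].
Qed.

(** Euclidean descent: a member that fails to divide some member is replaced by
    the remainder, which has smaller degree. *)
Lemma Omega_submod_principal {P0 : {poly K}} :
  (P0 : Omega f alpha) \in N -> P0 != 0 ->
  exists2 G : {poly K}, G != 0 /\ (G : Omega f alpha) \in N &
    forall Q : {poly K}, (Q : Omega f alpha) \in N -> G %| Q.
Proof.
have [n] := ubnP (size P0); elim: n P0 => // n IH P; rewrite ltnS => leP NP P0.
case: (boolp.pselect (exists2 Q : {poly K},
    (Q : Omega f alpha) \in N & ~~ (P %| Q))) => [[Q NQ ndvd]|noQ].
  apply: (IH (Q %% P)) => //.
    by rewrite (leq_trans _ leP) // ltn_modpN0.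
  rewrite -[Q %% P](addKr (Q %/ P * P)) -divp_eq addrC.
  by apply: rpredB => //; apply: Omega_submodM.
exists P => // Q NQ; apply/negPn/negP => ndvd; apply: noQ; by exists Q.
Qed.

End Submodule.
End Omega.

(** * Simplicity for nonzero alpha *)

Section ClosedField.
Context {K : numClosedFieldType} {Gamma : zmodClosed K} (f : mult_char Gamma).

(** A Nullstellensatz in one variable: a generator of the ideal either has a root
    or is an invertible constant. *)
Lemma Omega_submod_common_root {alpha : K} {N : lieSubmod (Omega f alpha)}
    {P : {poly K}} : (P : Omega f alpha) \in N -> P != 0 ->
  (exists r, forall Q : {poly K}, (Q : Omega f alpha) \in N -> root Q r) \/
  (forall Q : Omega f alpha, Q \in N).
Proof.
move=> NP P0; have [G [G0 NG] dvdG] := Omega_submod_principal NP P0.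
case: (boolP (size G != 1)) => [/closed_rootP[r Gr]|/negPn/size_poly1P[c c0 Gc]].
  by left; exists r => Q /dvdG /dvdpP[A ->]; rewrite rootM Gr orbT.
right=> Q; have /(rpredZ c^-1) := Omega_submodM Q NG.
by rewrite Gc mulrC mul_polyC scalerA mulVf // scale1r.
Qed.

(** A common zero r of a submodule would propagate to r + k for all large natural
    numbers k, which is impossible for a nonzero polynomial. *)
Lemma Omega_simple (alpha : K) : 1 \in Gamma -> alpha != 0 ->
  simple_lieMod (Omega f alpha).
Proof.
move=> Gamma1 alpha0; split; first by exists (1 : {poly K}); apply: oner_neq0.
move=> N.
case: (boolp.pselect (exists2 P : {poly K},
    (P : Omega f alpha) \in N & P != 0)) => [[P NP P0]|noP]; last first.
  by left=> P NP; apply/eqP/negPn/negP=> P0; apply: noP; exists P.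
right; case: (Omega_submod_common_root NP P0) => // -[r Nr].
have shift_root (k : nat) : r + k%:R * alpha != 0 -> root P (r + k%:R).
  move=> rk0; have Gk : k%:R \in Gamma by rewrite rpredMn.
  have := Nr _ (Omega_submod_shift (SubgroupElt Gk) NP).
  by rewrite rootM root_comp !rootE !hornerE (negPf rk0).
(* As alpha is nonzero, r + k alpha vanishes for at most one k. *)
have [n n_ok] : exists n : nat, forall k, (n < k)%N -> r + k%:R * alpha != 0.
  case: (boolp.pselect (exists n : nat, r + n%:R * alpha = 0)) => [[n rn]|no].
    exists n => k lt_nk; rewrite -(subnKC (ltnW lt_nk)) natrD mulrDl addrA rn.
    by rewrite add0r mulf_neq0 // pnatr_eq0 -lt0n subn_gt0.
  by exists 0%N => k _; apply/eqP=> rk; apply: no; exists k.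
pose s := [seq r + k%:R | k <- iota n.+1 (size P)].
have /(_ s) := max_poly_roots P0.
rewrite size_map size_iota ltnn => abs; suff: false by []; apply: abs.
  apply/allP => _ /mapP[k + ->]; rewrite mem_iota => /andP[lt_nk _].
  exact/shift_root/n_ok.
by rewrite map_inj_uniq ?iota_uniq // => i j /addrI /eqP; rewrite eqr_nat => /eqP.
Qed.

End ClosedField.

(** * The case alpha = 0 *)

Section OmegaZero.
Context {K : numFieldType} {Gamma : zmodClosed K} {f : mult_char Gamma}.

(** For alpha = 0 the polynomial part of L_m P is X P(X + m), divisible by X. *)
Lemma horner0_Omega0_act x (P : Omega f 0) :
  (lie_act x P : {poly K}).[0] = 0.
Proof.
rewrite Omega_actE /linext horner_sum big1 // => m _.
rewrite hornerZ /Omega_gen hornerZ hornerM hornerD hornerX hornerC.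
by rewrite mulr0 addr0 mul0r !mulr0.
Qed.

Lemma ex_Omega0_root0 :
  exists N : lieSubmod (Omega f 0), forall P : {poly K}, (P \in N) = root P 0.
Proof.
pose A : Omega f 0 -> bool := fun P => root (P : {poly K}) 0.
apply: (ex_lieSubmod A); first split.
- by rewrite unfold_in; apply: root0.
- move=> a P Q; rewrite !unfold_in /A !rootE => /eqP P0 /eqP Q0.
  by rewrite hornerD hornerZ P0 Q0 mulr0 addr0.
by move=> x P _; rewrite unfold_in /A rootE horner0_Omega0_act.
Qed.

Context {N : lieSubmod (Omega f 0)}.
Hypothesis NE : forall P : {poly K}, ((P : Omega f 0) \in N) = root P 0.

Fact mulX_root0 (P : {poly K}) : ('X * P : Omega f 0) \in N.
Proof. by rewrite NE rootM rootX eqxx. Qed.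

(** The isomorphism is division by X.  It intertwines the actions because
    substituting X + m for X turns X Q into (X + m) Q(X + m), which supplies the
    factor X + m alpha of the action with alpha = 1. *)
Lemma Omega0_sub_iso : lieMod_iso (subLieMod N) (Omega f 1).
Proof.
pose phi (u : subLieMod N) : Omega f 1 := drop_poly 1 (val u : {poly K}).
have phiE (u : subLieMod N) : 'X * phi u = val u :> {poly K}.
  have := valP u; rewrite NE => /factor_theorem[Q uE].
  by rewrite /phi uE subr0 -[X in drop_poly _ (_ * X)]expr1 drop_polyMXn_id mulrC.
have phi_eq (u : subLieMod N) (Q : {poly K}) :
    val u = 'X * Q :> {poly K} -> phi u = Q.
  by rewrite -phiE => /(mulfI (negbT (polyX_eq0 _))).
have phi_lin : linear phi.
  by move=> a u v; apply: phi_eq; rewrite mulrDr -scalerAr !phiE.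
apply: (lieMod_isoI phi) => //.
  exists (fun Q => SubLieMod (mulX_root0 Q)).
    by move=> u; apply: val_inj; apply: phiE.
  by move=> Q; apply: phi_eq.
move=> x u; apply: phi_eq => /=.
rewrite !Omega_actE /linext mulr_sumr; apply: eq_bigr => m _.
rewrite -phiE -[RHS]scalerAr; congr (_ *: _).
rewrite /Omega_gen mulr0 mulr1 addr0 -[RHS]scalerAr; congr (_ *: _).
by rewrite comp_polyM comp_polyX.
Qed.

(** The kernel of evaluation at 0 is N, and evaluation is equivariant because
    every L_m P vanishes at 0. *)
Lemma Omega0_quot_iso : lieMod_iso (quotLieMod N) (trivLieMod (witt Gamma)).
Proof.
pose pi (P : {poly K}) : quotLieMod N := (\pi_(quotLieMod N) (P : Omega f 0))%qT.
pose phi (u : quotLieMod N) : trivLieMod (witt Gamma) := (repr u : {poly K}).[0].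
have phi_pi (P : {poly K}) : phi (pi P) = P.[0].
  have /(quotLieMod_eq N) : pi (repr (pi P)) = pi P by rewrite /pi reprK.
  by rewrite NE rootE hornerD hornerN subr_eq0 => /eqP.
have piP u : exists P : {poly K}, u = pi P by exists (repr u); rewrite /pi reprK.
have phi_lin : linear phi.
  move=> a u v; have [[P ->] [Q ->]] := (piP u, piP v).
  have -> : a *: pi P + pi Q = pi (a *: P + Q).
    by rewrite /pi (quotLieMod_piD N) (quotLieMod_piZ N).
  by rewrite !phi_pi hornerD hornerZ.
apply: (lieMod_isoI phi) => //.
  exists (fun c : K => pi c%:P) => [u|c]; last by rewrite /= phi_pi hornerC.
  have [P ->] := piP u; rewrite /= phi_pi; apply/(quotLieMod_eq N).
  by rewrite NE rootE hornerD hornerN hornerC subrr.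
move=> x u; have [P ->] := piP u; rewrite /=.
have -> : lie_act x (pi P) = pi (lie_act x (P : Omega f 0)).
  by rewrite /pi (quotLieMod_pi_act N).
by rewrite phi_pi horner0_Omega0_act.
Qed.

Lemma Omega0_not_simple : ~ simple_lieMod (Omega f 0).
Proof.
case=> _ /(_ N)[/(_ ('X : {poly K}))|/(_ (1 : {poly K}))]; rewrite NE.
  by rewrite rootX eqxx => /(_ isT)/eqP; rewrite polyX_eq0.
by rewrite (negPf (root1 _)).
Qed.

(** N and N' meet: multiplication by X maps N' into itself and everything into N,
    and it is injective. *)
Lemma Omega0_simple_sub_unique (N' : lieSubmod (Omega f 0)) :
  simple_lieMod (subLieMod N) -> simple_lieMod (subLieMod N') -> N' =i N.
Proof.
move=> simN simN'; have [[[P N'P] P0] _] := simN'.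
have {}P0 : (P : {poly K}) != 0 by exact: P0.
have XP0 : 'X * (P : {poly K}) != 0 by rewrite mulf_neq0 ?polyX_eq0.
have [N'XP NXP] := (Omega_submodX N'P, mulX_root0 P).
move=> Q; apply/idP/idP.
  exact: (simple_subLieMod_sub simN' N'XP NXP XP0).
exact: (simple_subLieMod_sub simN NXP N'XP XP0).
Qed.

End OmegaZero.

Theorem theorem4p3 (R : realType) (Gamma : zmodClosed R[i])
    (Gamma1 : 1 \in Gamma) (f : mult_char Gamma) (alpha : R[i]) :
  (simple_lieMod (Omega f alpha) <-> alpha <> 0) /\
  (exists N : lieSubmod (Omega f 0),
     [/\ simple_lieMod (subLieMod N),
         forall N' : lieSubmod (Omega f 0),
           simple_lieMod (subLieMod N') -> N' =i N,
         lieMod_iso (subLieMod N) (Omega f 1)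
       & lieMod_iso (quotLieMod N) (trivLieMod (witt Gamma))]).
Proof.
have [N NE] := @ex_Omega0_root0 _ _ f.
have simN : simple_lieMod (subLieMod N).
  apply: simple_lieMod_iso (Omega0_sub_iso NE) _.
  exact/Omega_simple/oner_neq0.
split; first split=> [simO alpha0|/eqP].
- by subst alpha; apply: (Omega0_not_simple NE).
- exact: Omega_simple.
exists N; split=> //.
- by move=> N'; apply: Omega0_simple_sub_unique.
- exact: Omega0_sub_iso.
- exact: Omega0_quot_iso.
Qed.
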